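(* For every natural number $T$ there is a constant $c_T>0$, depending only on $T$, such that the following holds. Let $\mu_M>1$ and let $M$ be the negative real segment $$M=\{z\in\mathbb{C}: -\mu_M\le\operatorname{Re}z\le-1,\ \operatorname{Im}z=0\}.$$ Suppose that the set $\langle a\rangle=\{a_1,a_2,\dots,a_n\}$ successfully $\langle a,T\rangle$-stabilizes any cycle of length $T$ with multiplier $\mu\in M$. Then $$n\ge c_T\sqrt{\mu_M}.$$
   Context: $\Delta=\{z\in\mathbb{C}:|z|<1\}$. An averaging set $\langle a\rangle=\{a_1,\dots,a_n\}$ is a finite sequence of complex numbers with $a_1+\dots+a_n=1$ and $a_1\ne0$. Put $p(z)=a_n+a_{n-1}z+\dots+a_1z^{n-1}$. By definition, $\langle a\rangle$ $\langle a,T\rangle$-stabilizes a cycle of length $T$ with multiplier $\mu$ if and only if all roots of $\chi_T(z)=z^{(n-1)T+1}-\mu\,(p(z))^T$ lie in $\Delta$. (So the hypothesis says that for every $\mu\in M$ all roots of $\chi_T$ lie in $\Delta$.) *)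

(* Defs.v *)
From HB Require Import structures.
From mathcomp Require Import all_boot all_order all_algebra.
From mathcomp Require Import complex.
From mathcomp Require Import classical_sets reals.

Set Implicit Arguments.
Unset Strict Implicit.
Unset Printing Implicit Defensive.

Import Order.TTheory GRing.Theory Num.Theory.
Local Open Scope ring_scope.
Local Open Scope classical_set_scope.

Section AveragingSets.
Variable R : realType.

Definition unit_disk : set R[i] := [set z | `|z| < 1].

(* A finite sequence a_1, ..., a_n is an n-tuple; a_k is a`_(k - 1). *)
Definition averaging_set (n : nat) (a : n.-tuple R[i]) : Prop :=
  \sum_(x <- a) x = 1 /\ a`_0 != 0.

(* p(z) = a_n + a_(n-1) z + ... + a_1 z^(n-1): the coefficient of z^i is
   a_(n-i), i.e. the entry of index n - i - 1. *)
Definition averaging_poly (n : nat) (a : n.-tuple R[i]) : {poly R[i]} :=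
  \poly_(i < n) a`_(n - i.+1).

(* The truncated n.-1 is harmless: an averaging set has n >= 1. *)
Definition char_poly_cycle (n : nat) (a : n.-tuple R[i]) (T : nat) (mu : R[i]) :
    {poly R[i]} :=
  'X^(n.-1 * T + 1) - mu *: averaging_poly a ^+ T.

Definition stabilizes (n : nat) (a : n.-tuple R[i]) (T : nat) (mu : R[i]) :
    Prop :=
  forall z : R[i], root (char_poly_cycle a T mu) z -> unit_disk z.

Definition negative_segment (muM : R) : set R[i] :=
  [set z | - muM <= complex.Re z <= -1 /\ complex.Im z = 0].

End AveragingSets.

(* Main.v *)
(* With q(w) = a_1 + a_2 w + ... + a_n w^(n-1) and F = w q^T, the roots of chi_T
   are the 1/w with mu F(w) = 1. So F is a polynomial of degree at most
   N = (n-1)T + 1 with F(0) = 0 and F(1) = 1, and the hypothesis says that on the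
   closed unit disk F omits the segment [-1, -t^2] where t = 1/sqrt(mu_M).
   Compose F with the inverse Joukowski map K of the complement of this segment:
   |K| < 1 and 1 - K(0) = 2t/(1+t), so by Caratheodory's coefficient bound for
   functions of positive real part |1 - K| <= 1/2, hence |F| <= 1/4, on the disk
   of radius r = 1 - 8t. By the Bernstein-Walsh growth bound
   1 = |F(1)| <= r^(-N)/4, which forces N t to be bounded below.
   No complex analysis is needed: since F omits the segment, the square root in K
   is a uniform limit of polynomials, and coefficients of polynomials are averages
   over roots of unity. *)
Require Import Defs.
From HB Require Import structures.
From mathcomp Require Import all_boot all_order all_algebra.
From mathcomp Require Import complex.
From mathcomp Require Import classical_sets reals.
From mathcomp Require Import ring lra zify cyclic separable cyclotomic.

Set Implicit Arguments.
Unset Strict Implicit.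
Unset Printing Implicit Defensive.

Import Order.TTheory GRing.Theory Num.Theory.
Import ComplexField.Normc.
Local Open Scope ring_scope.
Local Open Scope classical_set_scope.

(** * Modulus, real part and imaginary part of complex numbers *)

Section ComplexModulus.
Variable R : rcfType.
Implicit Types (x : R) (z w : R[i]).

Lemma normcE_norm z : `|z| = (normc z)%:C%C.
Proof. by []. Qed.

Lemma normc_ge0 z : 0 <= normc z.
Proof. by case: z => a b; exact: sqrtr_ge0. Qed.

Lemma normcX z k : normc (z ^+ k) = normc z ^+ k.
Proof.
by elim: k => [|k IH]; rewrite ?expr0 ?normc1 // !exprS normcM IH.
Qed.

Lemma normc_real x : normc x%:C%C = `|x|.
Proof. by rewrite /= expr0n addr0 sqrtr_sqr. Qed.

Lemma ge0_normc_real x : 0 <= x -> normc x%:C%C = x.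
Proof. by move=> x0; rewrite normc_real ger0_norm. Qed.

Lemma normc_nat k : normc (k%:R : R[i]) = k%:R.
Proof. by rewrite -(rmorph_nat (real_complex R)) ge0_normc_real ?ler0n. Qed.

Lemma normc_sum (I : Type) (r : seq I) (F : I -> R[i]) :
  normc (\sum_(i <- r) F i) <= \sum_(i <- r) normc (F i).
Proof.
elim/big_rec2: _ => [|i y z _ le_zy]; first by rewrite normc0.
by apply: le_trans (le_normcD _ _) _; rewrite lerD2l.
Qed.

Lemma normcBC z w : normc (z - w) = normc (w - z).
Proof. by rewrite -normcN opprB. Qed.

Lemma ler_normcB z w : normc z - normc w <= normc (z + w).
Proof. by have := le_normcD (z + w) (- w); rewrite addrK normcN; lra. Qed.

Lemma ler_Re_normc z : `|complex.Re z| <= normc z.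
Proof.
case: z => a b /=; rewrite -sqrtr_sqr ler_wsqrtr // lerDl sqr_ge0 //.
Qed.

Lemma normc_Re_Im z : normc z ^+ 2 = complex.Re z ^+ 2 + complex.Im z ^+ 2.
Proof. by case: z => a b /=; rewrite sqr_sqrtr // addr_ge0 ?sqr_ge0. Qed.

Lemma mul_conjc z : z * conjc z = (normc z ^+ 2)%:C%C.
Proof. by rewrite -sqr_normc normcE_norm -rmorphXn. Qed.

Lemma normc_conj z : normc (conjc z) = normc z.
Proof. by case: z => a b /=; rewrite sqrrN. Qed.

Lemma addc_conjc z : z + conjc z = (2 * complex.Re z)%:C%C.
Proof. by rewrite addcJ rmorphM rmorph_nat. Qed.

Lemma ReD z w : complex.Re (z + w) = complex.Re z + complex.Re w.
Proof. by case: z; case: w. Qed.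

Lemma Re_sum (I : Type) (r : seq I) (F : I -> R[i]) :
  complex.Re (\sum_(i <- r) F i) = \sum_(i <- r) complex.Re (F i).
Proof. by elim/big_rec2: _ => // i y z _ <-; rewrite ReD. Qed.

Lemma ImD z w : complex.Im (z + w) = complex.Im z + complex.Im w.
Proof. by case: z; case: w. Qed.

Lemma Im_sum (I : Type) (r : seq I) (F : I -> R[i]) :
  complex.Im (\sum_(i <- r) F i) = \sum_(i <- r) complex.Im (F i).
Proof. by elim/big_rec2: _ => // i y z _ <-; rewrite ImD. Qed.

Lemma Re_Mreal z x : complex.Re (z * x%:C%C) = complex.Re z * x.
Proof. by case: z => a b /=; rewrite mulr0 subr0. Qed.

Lemma Im_Mreal z x : complex.Im (z * x%:C%C) = complex.Im z * x.
Proof. by case: z => a b /=; rewrite mulr0 add0r. Qed.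

End ComplexModulus.

(** * Coefficients of polynomials as averages over roots of unity *)

Section CoefficientBounds.

(** For [n] nonzero in [F], [X^n - 1] is separable and so has [n] distinct roots; [n] distinct
    [n]-th roots of unity include a primitive one. *)
Lemma closed_field_prim_root (F : closedFieldType) (n : nat) :
  n%:R != 0 :> F -> exists w : F, n.-primitive_root w.
Proof.
move=> nF; have n_gt0 : (0 < n)%N by case: n nF => //; rewrite eqxx.
have [r] := closed_field_poly_normal ('X^n - 1 : {poly F}).
rewrite (monicP _) ?monicXnsubC // scale1r => Xn1.
have sz_r : (n <= size r)%N.
  by rewrite -ltnS -(size_prod_XsubC r id) -Xn1 size_XnsubC.
have r_unity : all n.-unity_root r.
  by apply/allP => z; rewrite -root_prod_XsubC -Xn1.
have r_uniq : uniq r by rewrite -separable_prod_XsubC -Xn1 separable_Xn_sub_1.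
by have [w _ w_prim] := hasP (has_prim_root n_gt0 r_unity r_uniq sz_r); exists w.
Qed.

Lemma prim_root_sum (F : fieldType) (n : nat) (w : F) m : n.-primitive_root w ->
  \sum_(j < n) w ^+ (j * m) = if (n %| m)%N then n%:R else 0.
Proof.
move=> w_prim; case: ifPn => [n_m | nn_m].
  rewrite (eq_bigr (fun=> 1)) => [|j _]; first by rewrite sumr_const card_ord.
  by apply/eqP; rewrite -(prim_order_dvd w_prim) dvdn_mull.
have wm1 : w ^+ m - 1 != 0 by rewrite subr_eq0 -(prim_order_dvd w_prim).
apply: (mulfI wm1); rewrite mulr0.
rewrite (eq_bigr (fun j : 'I_n => (w ^+ m) ^+ j)) => [|j _].
  by rewrite -subrX1 exprAC (prim_expr_order w_prim) expr1n subrr.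
by rewrite mulnC exprM.
Qed.

(** Discrete Fourier inversion; the frequency [m] stands for [-(n - m)], so that no inverse of [w]
    occurs. *)
Lemma prim_root_coef (F : fieldType) (n : nat) (w : F) (p : {poly F}) m :
    n.-primitive_root w -> (size p <= n)%N -> (0 < m <= n)%N ->
  \sum_(j < n) p.[w ^+ j] * w ^+ (j * m) = n%:R * p`_(n - m).
Proof.
move=> w_prim sz_p /andP[m_gt0 m_le].
transitivity (\sum_(i < n) p`_i * \sum_(j < n) w ^+ (j * (i + m))).
  under [RHS]eq_bigr do rewrite mulr_sumr.
  rewrite exchange_big /=; apply: eq_bigr => j _.
  rewrite (horner_coef_wide _ sz_p) mulr_suml; apply: eq_bigr => i _.
  by rewrite -exprM -mulrA -exprD mulnDr.
under eq_bigr do rewrite prim_root_sum //.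
have k_lt : (n - m < n)%N by rewrite ltn_subrL m_gt0 (leq_trans m_gt0).
rewrite (bigD1 (Ordinal k_lt)) //= subnK // dvdnn big1 ?addr0 1?mulrC // => i.
(* Since [0 < i + m < 2n], divisibility by [n] would force [i + m = n]. *)
rewrite -val_eqE /= => ik; case: ifPn => [/dvdnP[q iq]|]; rewrite ?mulr0 //.
have i_lt := ltn_ord i; case/eqP: ik.
case: q iq => [|[|q]]; rewrite ?mulSn; lia.
Qed.

Variable R : rcfType.
Implicit Types (p : {poly R[i]}) (w : R[i]).

Lemma complex_prim_root n : (0 < n)%N ->
  exists2 w : R[i], n.-primitive_root w & forall j, normc (w ^+ j) = 1.
Proof.
move=> n_gt0; have [|w w_prim] := @closed_field_prim_root R[i] n.
  by rewrite pnatr_eq0 -lt0n.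
exists w => // j; rewrite normcX; suff -> : normc w = 1 by rewrite expr1n.
apply/eqP; rewrite -(@pexpr_eq1 _ _ n) ?normc_ge0 //.
by rewrite -normcX (prim_expr_order w_prim) normc1.
Qed.

(** Cauchy's estimate, with the integral replaced by an average over roots of unity of an order
    exceeding the degree. *)
Lemma normc_coef_le p B k : (forall w, normc w = 1 -> normc p.[w] <= B) ->
  normc p`_k <= B.
Proof.
move=> pB; pose n := (k + size p).+1.
have [w w_prim w1] := @complex_prim_root n isT.
have sz_p : (size p <= n)%N by rewrite /n; lia.
have k_lt : (0 < n - k <= n)%N by rewrite /n; lia.
have coef_k := prim_root_coef w_prim sz_p k_lt.
rewrite subKn in coef_k; last by rewrite /n; lia.
rewrite -(ler_pM2l (ltr0Sn R (k + size p))) -normc_nat -normcM -coef_k.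
apply: le_trans (normc_sum _ _) _.
rewrite normc_nat mulr_natl -[X in _ *+ X](card_ord n) -sumr_const.
by apply: ler_sum => j _; rewrite normcM w1 mulr1 pB.
Qed.

(* On the unit circle [p + conj p] has the same positive frequencies as [p],
   since those of [conj p] are negative. *)
Lemma normc_coef_le_Re p k : (0 < k)%N ->
    (forall w, normc w = 1 -> 0 <= complex.Re p.[w]) ->
  normc p`_k <= 2 * complex.Re p`_0.
Proof.
(* With this [n] and [m = n - k], frequency [m] picks [p_k] out of [p], but out of the conjugate
   only the conjugate of [p_m], which vanishes because [m] exceeds the degree. *)
move=> k_gt0 p_ge0; pose n := (k + (size p).+1)%N.
have n_gt0 : (0 < n)%N by rewrite /n addnS.
have n_pos : 0 < n%:R :> R by rewrite ltr0n.
have [w w_prim w1] := complex_prim_root n_gt0.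
have sz_p : (size p <= n)%N by rewrite /n; lia.
pose m := (size p).+1.
have pos_freq : \sum_(j < n) p.[w ^+ j] * w ^+ (j * m) = n%:R * p`_k.
  by rewrite (prim_root_coef w_prim sz_p) /n /m ?addnK //; lia.
have neg_freq : \sum_(j < n) conjc p.[w ^+ j] * w ^+ (j * m) = 0.
  have := prim_root_coef w_prim sz_p (_ : 0 < k <= n)%N.
  rewrite k_gt0 leq_addr => /(_ isT); rewrite {2}/n addKn nth_default // mulr0.
  move/(congr1 (@conjc R)); rewrite rmorph0 rmorph_sum /= => conj0.
  rewrite -[RHS]conj0.
  apply: eq_bigr => j _; rewrite rmorphM; congr (_ * _).
  have wjk : w ^+ (j * k) != 0.
    by apply: contraTneq (oner_neq0 R) => w0; rewrite -(w1 (j * k)%N) w0 normc0 eqxx.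
  apply: (mulfI wjk); rewrite mul_conjc w1 expr1n -exprD -mulnDr.
  by rewrite mulnC exprM (prim_expr_order w_prim) expr1n.
have zero_freq : \sum_(j < n) complex.Re p.[w ^+ j] = n%:R * complex.Re p`_0.
  have := prim_root_coef w_prim sz_p (_ : 0 < n <= n)%N.
  rewrite n_gt0 leqnn subnn => /(_ isT) /(congr1 (@complex.Re R)).
  rewrite Re_sum [X in _ = complex.Re X]mulrC -(rmorph_nat (real_complex R)).
  rewrite Re_Mreal mulrC => <-; apply: eq_bigr => j _.
  by rewrite mulnC exprM (prim_expr_order w_prim) expr1n mulr1.
rewrite -(ler_pM2l n_pos) -{1}(normc_nat R) -normcM -pos_freq.
have -> : \sum_(j < n) p.[w ^+ j] * w ^+ (j * m) =
    \sum_(j < n) (p.[w ^+ j] + conjc p.[w ^+ j]) * w ^+ (j * m).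
  rewrite -[LHS]addr0 -[X in _ + X]neg_freq -big_split /=.
  by apply: eq_bigr => j _; rewrite mulrDl.
rewrite mulrCA -zero_freq mulr_sumr.
apply: le_trans (normc_sum _ _) _; apply: ler_sum => j _.
rewrite addc_conjc normcM w1 mulr1 ge0_normc_real //.
by rewrite mulr_ge0 ?ler0n // p_ge0.
Qed.

End CoefficientBounds.

(** * Geometric estimates and growth of polynomials outside a disk *)

Section PowerBounds.

Lemma bernoulli_ge (R : realDomainType) (x : R) k : -1 <= x ->
  1 + k%:R * x <= (1 + x) ^+ k.
Proof.
move=> x_ge; elim: k => [|k IH]; first by rewrite expr0 mul0r addr0.
rewrite exprS -natr1; have x1 : 0 <= 1 + x by lra.
apply: le_trans (ler_wpM2l x1 IH).
have : 0 <= k%:R * x ^+ 2 by rewrite mulr_ge0 ?ler0n ?sqr_ge0.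
by rewrite expr2; nra.
Qed.

Lemma exists_expr_le (R : archiRealFieldType) (r d : R) :
  0 <= r < 1 -> 0 < d -> exists k, r ^+ k <= d.
Proof.
move=> /andP[r_ge0 r_lt1] d_gt0; have [->|r_neq0] := eqVneq r 0.
  by exists 1%N; rewrite expr1 (ltW d_gt0).
have r_gt0 : 0 < r by rewrite lt_def r_neq0.
have t_gt0 : 0 < r^-1 - 1 by rewrite subr_gt0 invf_gt1.
pose y := d^-1 / (r^-1 - 1).
have y_ge0 : 0 <= y by apply: divr_ge0; rewrite ?invr_ge0; exact: ltW.
exists (Num.bound y); rewrite -(invrK d) -[leLHS]invrK lef_pV2 ?posrE ?invr_gt0 ?exprn_gt0 //.
rewrite -exprVn -[r^-1](subrK 1) [_ - 1 + 1]addrC.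
apply: le_trans (bernoulli_ge _ _); last by lra.
have := archi_boundP y_ge0; rewrite ltr_pdivrMr // => /ltW d_le.
by apply: le_trans d_le _; rewrite lerDr.
Qed.

Lemma sum_expr_le (R : realFieldType) (r : R) k : 0 <= r < 1 ->
  \sum_(i < k) r ^+ i <= (1 - r)^-1.
Proof.
move=> /andP[r_ge0 r_lt1]; have r1 : 0 < 1 - r by rewrite subr_gt0.
rewrite -(ler_pM2l r1) divff ?gt_eqF // -opprB mulNr -subrX1 opprB.
by rewrite gerBl exprn_ge0.
Qed.

Lemma normc_horner_le (R : rcfType) (p : {poly R[i]}) (w : R[i]) (B r : R) :
    (forall k, normc p`_k <= B) -> 0 <= B -> r < 1 -> normc w <= r ->
  normc p.[w] <= B / (1 - r).
Proof.
move=> pB B_ge0 r_lt1 w_le; rewrite horner_coef.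
apply: le_trans (normc_sum _ _) _.
have r01 : 0 <= r < 1 by rewrite (le_trans (normc_ge0 w)).
apply: le_trans (ler_wpM2l B_ge0 (sum_expr_le (size p) r01)).
rewrite mulr_sumr; apply: ler_sum => i _; rewrite normcM normcX.
by rewrite ler_pM ?normc_ge0 ?exprn_ge0 // ?normc_ge0 // lerXn2r ?nnegrE ?normc_ge0 //; case/andP: r01.
Qed.

(* The crude coefficient bound loses a factor of the order of the degree, which
   disappears when it is applied to the powers of [p]. *)
Lemma normc_horner1_le (R : realType) (p : {poly R[i]}) N (r h : R) :
    (size p <= N.+1)%N -> 0 < r < 1 ->
    (forall w, normc w = r -> normc p.[w] <= h) ->
  r ^+ N * normc p.[1] <= h.
Proof.
move=> sz_p /andP[r_gt0 r_lt1] ph; set y := r ^+ N * _.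
have h_ge0 : 0 <= h.
  by apply: le_trans (ph r%:C%C _); rewrite ?normc_ge0 // ge0_normc_real ?ltW.
rewrite leNgt; apply/negP => h_lt_y.
have y_gt0 : 0 < y by apply: le_lt_trans h_lt_y.
(* The coefficients [c_i] of [p^m] satisfy [r^i |c_i| <= h^m], so [y^m = r^(N m) |p(1)|^m] is at
   most [h^m] times a geometric series in [r]. *)
have powers m : (1 - r) * y ^+ m <= h ^+ m.
  pose pm := p ^+ m; have sz_pm : (size pm <= (N * m).+1)%N.
    have := size_poly_exp_leq p m; move=> /leq_trans; apply.
    by rewrite ltnS leq_mul2r -subn1 leq_subLR add1n sz_p orbT.
  have coef_pm k : r ^+ k * normc pm`_k <= h ^+ m.
    pose q := \poly_(i < size pm) (r%:C%C ^+ i * pm`_i).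
    have <- : normc q`_k = r ^+ k * normc pm`_k.
      rewrite coef_poly; case: ltnP => [_|sz_k].
        by rewrite normcM normcX ge0_normc_real ?ltW.
      by rewrite nth_default // normc0 mulr0.
    apply: normc_coef_le => w w1.
    have -> : q.[w] = pm.[r%:C%C * w].
      rewrite horner_poly horner_coef; apply: eq_bigr => i _.
      by rewrite exprMn mulrCA mulrA.
    rewrite horner_exp normcX lerXn2r ?nnegrE ?normc_ge0 // ph // normcM w1.
    by rewrite mulr1 ge0_normc_real ?ltW.
  rewrite -ler_pdivlMl ?subr_gt0 // mulrC.
  have r01 : 0 <= r < 1 by rewrite ltW.
  have hm_ge0 : 0 <= h ^+ m by rewrite exprn_ge0.
  apply: le_trans (ler_wpM2l hm_ge0 (sum_expr_le (N * m).+1 r01)).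
  rewrite /y exprMn -exprM -normcX -horner_exp (horner_coef_wide _ sz_pm).
  apply: le_trans (ler_wpM2l _ (normc_sum _ _)) _; first exact/exprn_ge0/ltW.
  rewrite mulr_sumr mulr_sumr (reindex_inj rev_ord_inj) /=.
  apply: ler_sum => i _; rewrite expr1n mulr1 subSS.
  have i_le : (i <= N * m)%N by rewrite -ltnS.
  rewrite -{1}(subnKC i_le) exprD -mulrA mulrC.
  by rewrite ler_wpM2r ?exprn_ge0 ?coef_pm // ltW.
(* The powers of [h / y < 1] tend to 0, yet [powers] keeps them above [1 - r]. *)
have [||k] := @exists_expr_le R (h / y) ((1 - r) / 2).
  by rewrite ltr_pdivrMr // mul1r h_lt_y andbT divr_ge0 // ltW.
  by rewrite divr_gt0 // subr_gt0.
rewrite expr_div_n ler_pdivrMr ?exprn_gt0 // leNgt => /negP; apply.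
apply: lt_le_trans (powers k).
by rewrite ltr_pM2r ?exprn_gt0 //; lra.
Qed.

End PowerBounds.

(** * Polynomial approximation of square roots on the closed disk *)

Section SquareRoots.
Variable R : realType.
Implicit Types (p Q W : {poly R[i]}) (u w z : R[i]) (d : R).

(* [1 - sqrt (1 - x)] is the fixed point of [s |-> (x + s^2) / 2]. *)
Lemma sqrt_approx_linear u d : normc u < 1 -> 0 < d ->
  exists2 W, W.[0] = 1 &
    forall w, normc w <= 1 -> normc (W.[w] ^+ 2 - (1 - u * w)) <= d.
Proof.
move=> u1 d_gt0; have u0 := normc_ge0 u.
pose s k := iter k (fun p => 2^-1 *: (u *: 'X + p ^+ 2)) (0 : {poly R[i]}).
have sS k w : (s k.+1).[w] = 2^-1 * (u * w + (s k).[w] ^+ 2).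
  by rewrite /= !hornerE.
have half : normc (2^-1 : R[i]) = 2^-1 by rewrite normcV normc_nat.
have s_le k w : normc w <= 1 -> normc (s k).[w] <= normc u.
  move=> w1; elim: k => [|k IH]; first by rewrite horner0 normc0.
  have w0 := normc_ge0 w; have sk0 := normc_ge0 (s k).[w].
  rewrite sS normcM half; have := le_normcD (u * w) ((s k).[w] ^+ 2).
  by rewrite normcM normcX; nra.
(* An increment is half a difference of squares, whose sum factor is at most [2 |u|]: the iteration
   contracts with ratio [|u|]. *)
have s_cauchy k w : normc w <= 1 ->
    normc ((s k.+1).[w] - (s k).[w]) <= normc u ^+ k.
  move=> w1; elim: k => [|k IH].
    by rewrite horner0 subr0 expr0 (le_trans (s_le 1%N w w1)) // ltW.
  have -> : (s k.+2).[w] - (s k.+1).[w] =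
      2^-1 * (((s k.+1).[w] - (s k).[w]) * ((s k.+1).[w] + (s k).[w])).
    by rewrite (sS k.+1) {2}sS; ring.
  rewrite normcM half normcM exprSr.
  have := le_normcD (s k.+1).[w] (s k).[w].
  have := s_le k w w1; have := s_le k.+1 w w1.
  have := normc_ge0 ((s k.+1).[w] + (s k).[w]).
  have := normc_ge0 ((s k.+1).[w] - (s k).[w]).
  have : 0 <= normc u ^+ k by rewrite exprn_ge0.
  move: IH; set A := normc (_ - _); set B := normc (_ + _); set U := _ ^+ k.
  move=> AU U0 A0 B0 h1 h2 h3; have B2 : B <= 2 * normc u by lra.
  by have := ler_pM A0 B0 AU B2; lra.
have [||k uk] := @exists_expr_le R (normc u) (d / 2); first by rewrite u0.
  by rewrite divr_gt0.
exists (1 - s k) => [|w w1].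
  rewrite !hornerE; elim: (k) => [|j IH]; first by rewrite horner0 subr0.
  have sj0 : (s j).[0] = 0 by rewrite -[LHS](subKr 1) IH subrr.
  by rewrite sS sj0 mulr0 expr0n addr0 mulr0 subr0.
have -> : (1 - s k).[w] ^+ 2 - (1 - u * w) = 2 * ((s k.+1).[w] - (s k).[w]).
  by rewrite sS !hornerE; field.
by rewrite normcM normc_nat; have := s_cauchy k w w1; lra.
Qed.

(** Approximate roots of the linear factors are multiplied together; each new factor gets half of
    the error budget. *)
Lemma sqrt_approx_prod (us : seq R[i]) d :
    (forall u, u \in us -> normc u < 1) -> 0 < d ->
  exists2 W, W.[0] = 1 & forall w, normc w <= 1 ->
    normc (W.[w] ^+ 2 - \prod_(u <- us) (1 - u * w)) <= d.
Proof.
elim: us d => [|u us IH] d us1 d_gt0.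
  exists 1 => [|w _]; first by rewrite hornerE.
  by rewrite big_nil hornerE expr1n subrr normc0 ltW.
pose B : R := 2 ^+ size us.
have B_gt0 : 0 < B by rewrite exprn_gt0.
have prod_le w : normc w <= 1 -> normc (\prod_(v <- us) (1 - v * w)) <= B.
  move=> w1; rewrite /B; have : forall v, v \in us -> normc v < 1.
    by move=> v vus; apply: us1; rewrite inE vus orbT.
  elim: (us) => [|v vs IHv] vs1; first by rewrite big_nil normc1 expr0.
  rewrite big_cons normcM exprS ler_pM ?normc_ge0 ?IHv //.
    have := le_normcD 1 (- (v * w)); rewrite normcN normc1 normcM.
    have := vs1 v (mem_head _ _); have := normc_ge0 v; have := normc_ge0 w.
    by nra.
  by move=> v' v'vs; apply: vs1; rewrite inE v'vs orbT.
(* The bound 1 gives [|W^2| <= B + 1]; the bound [d / 4], multiplied by [|1 - u w| <= 2], costs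
   [d / 2]. *)
have [||W W0 Wsqr] := IH (Num.min 1 (d / 4)).
- by move=> v vus; apply: us1; rewrite inE vus orbT.
- by rewrite lt_min ltr01 divr_gt0.
have [||V V0 Vsqr] := @sqrt_approx_linear u (d / 2 / (B + 1)).
- by apply: us1; rewrite mem_head.
- by rewrite !divr_gt0 // addr_gt0.
exists (V * W) => [|w w1]; first by rewrite hornerM V0 W0 mulr1.
rewrite big_cons hornerM; move: (Vsqr w w1) (Wsqr w w1) (prod_le w w1).
move: (\prod_(v <- us) _) => P; rewrite le_min => eV /andP[eW1 eW] P_le.
have -> : (V.[w] * W.[w]) ^+ 2 - (1 - u * w) * P =
    (V.[w] ^+ 2 - (1 - u * w)) * W.[w] ^+ 2 + (1 - u * w) * (W.[w] ^+ 2 - P).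
  by ring.
have W_le : normc (W.[w] ^+ 2) <= B + 1.
  by have := le_normcD (W.[w] ^+ 2 - P) P; rewrite subrK; lra.
have u_le : normc (1 - u * w) <= 2.
  have := le_normcD 1 (- (u * w)); rewrite normcN normc1 normcM.
  have := us1 u (mem_head _ _); have := normc_ge0 u; have := normc_ge0 w.
  by nra.
move: (W.[w] ^+ 2) (V.[w] ^+ 2) eV eW W_le {eW1} => W2 V2 eV eW W_le.
rewrite (splitr d); apply: le_trans (le_normcD _ _) _; rewrite !normcM lerD //.
  apply: le_trans (ler_pM (normc_ge0 _) (normc_ge0 _) eV W_le) _.
  by rewrite divfK // gt_eqF // addr_gt0.
apply: le_trans (ler_pM (normc_ge0 _) (normc_ge0 _) u_le eW) _.
by rewrite mulrCA ler_pM2l //; lra.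
Qed.

(** All zeros [z] of [Q] lie outside the closed disk, so [Q] is [q^2] times the product of the
    factors [1 - w / z] with [|1 / z| < 1]. *)
Lemma sqrt_approx Q q d : Q.[0] = q ^+ 2 -> 0 < d ->
    (forall w, normc w <= 1 -> Q.[w] != 0) ->
  exists2 W, W.[0] = q & forall w, normc w <= 1 ->
    normc (W.[w] ^+ 2 - Q.[w]) <= d.
Proof.
move=> Q0 d_gt0 Q_neq0; have [rs Q_rs] := closed_field_poly_normal Q.
have Q00 : Q.[0] != 0 by rewrite Q_neq0 // normc0 ler01.
have rs1 z : z \in rs -> 1 < normc z.
  move=> z_rs; rewrite ltNge; apply/negP => /Q_neq0.
  by rewrite Q_rs hornerZ; rewrite -root_prod_XsubC in z_rs; rewrite (rootP z_rs) mulr0 eqxx.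
have horner_Q w : Q.[w] = q ^+ 2 * \prod_(u <- [seq z^-1 | z <- rs]) (1 - u * w).
  rewrite -Q0 Q_rs !hornerZ !horner_prod -mulrA big_map -big_split /=; congr (_ * _).
  rewrite !big_seq; apply: eq_bigr => z z_rs; rewrite !hornerXsubC.
  have z0 : z != 0 by apply: contraTneq (rs1 z z_rs) => ->; rewrite normc0 -leNgt ler01.
  by field.
have q_gt0 : 0 < normc q ^+ 2.
  rewrite exprn_gt0 // lt_def normc_ge0 andbT.
  by apply: contraNneq Q00 => /eq0_normc q0; rewrite Q0 q0 expr0n.
have [||W W0 Wsqr] := @sqrt_approx_prod [seq z^-1 | z <- rs] (d / normc q ^+ 2).
- by move=> _ /mapP[z z_rs ->]; rewrite normcV invf_lt1 ?rs1 // (lt_trans ltr01) ?rs1.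
- by rewrite divr_gt0.
exists (q *: W) => [|w w1]; first by rewrite hornerZ W0 mulr1.
rewrite horner_Q hornerZ exprMn -mulrBr normcM normcX mulrC.
by rewrite -ler_pdivlMr ?Wsqr.
Qed.

End SquareRoots.

(** * Uniform lower bounds and intermediate values *)

Section Continuity.

(** Compactness of [[a, b]] through a supremum: the bound [d0] at [sup E] persists as [d0 / 2] at
    distance up to [d0 / 2], uniformly in [x]. *)
Lemma lipschitz_uniform_lower_bound (R : realType) (X : Type) (D : set X)
    (f : X -> R -> R) (a b : R) :
    (forall x s t, f x t <= f x s + `|s - t|) ->
    (forall s, a <= s <= b -> exists2 d, 0 < d & forall x, D x -> d <= f x s) ->
  exists2 d, 0 < d & forall s x, a <= s <= b -> D x -> d <= f x s.
Proof.
move=> f_lip f_gt0; have [ab|ba] := leP a b; last first.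
  by exists 1 => // s x /andP[sa sb]; have := le_trans sa sb; rewrite leNgt ba.
pose E := [set t | a <= t <= b /\ exists2 d, 0 < d &
  forall s x, a <= s <= t -> D x -> d <= f x s].
have Ea : E a.
  split; first by rewrite lexx.
  have [|d d_gt0 fd] := f_gt0 a; first by rewrite lexx.
  by exists d => // s x /le_anti <-; exact: fd.
have E_ub : ubound E b by move=> t [/andP[]].
have supE : has_sup E by split; [exists a | exists b].
have c_ab : a <= sup E <= b.
  by rewrite ge_sup ?ub_le_sup //; [exact: supE.2|exact: supE.1].
have [d0 d0_gt0 fd0] := f_gt0 _ c_ab.
have d2_gt0 : 0 < d0 / 2 by rewrite divr_gt0.
have [t [/andP[at_ tb] [d d_gt0 fd]] t_gt] := sup_adherent d2_gt0 supE.
pose t' := Num.min b (sup E + d0 / 2).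
have t'E : forall s x, a <= s <= t' -> D x -> Num.min d (d0 / 2) <= f x s.
  move=> s x /andP[as_]; rewrite le_min => /andP[sb sc] Dx; rewrite ge_min.
  have [st|ts] := leP s t; first by rewrite fd ?as_.
  have := f_lip x s (sup E); have := fd0 x Dx.
  have : `|s - sup E| <= d0 / 2 by rewrite ler_norml; apply/andP; split; lra.
  by move=> h1 h2 h3; apply/orP; right; lra.
have m_gt0 : 0 < Num.min d (d0 / 2) by rewrite lt_min d_gt0.
exists (Num.min d (d0 / 2)) => // s x /andP[as_ sb] Dx; apply: (t'E) => //.
(* Were [sup E + d0 / 2] below [b], it would be an element of [E] beyond its supremum. *)
rewrite as_ (le_trans sb) // /t' le_min lexx /= leNgt; apply/negP => cb.
have t'_eq : t' = sup E + d0 / 2 by rewrite /t' min_r // ltW.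
have : E t'.
  split; last by exists (Num.min d (d0 / 2)).
  by rewrite t'_eq (ltW cb) andbT; case/andP: c_ab; lra.
by move/(ub_le_sup supE.2); rewrite t'_eq; lra.
Qed.

(** Each root [z] has [|z| > 1], and [|w - z| >= |z| - 1] on the closed disk. *)
Lemma horner_lower_bound (R : rcfType) (p : {poly R[i]}) :
    (forall w, normc w <= 1 -> p.[w] != 0) ->
  exists2 d, 0 < d & forall w, normc w <= 1 -> d <= normc p.[w].
Proof.
move=> p_neq0; have [rs p_rs] := closed_field_poly_normal p.
have rs1 z : z \in rs -> 0 < normc z - 1.
  move=> z_rs; rewrite subr_gt0 ltNge; apply/negP => /p_neq0.
  rewrite p_rs hornerZ; rewrite -root_prod_XsubC in z_rs.
  by rewrite (rootP z_rs) mulr0 eqxx.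
have c_gt0 : 0 < normc (lead_coef p).
  rewrite lt_def normc_ge0 andbT; apply/eqP => /eq0_normc c0.
  have := p_neq0 0; rewrite normc0 ler01 p_rs c0 scale0r horner0 eqxx.
  by move=> /(_ isT).
exists (normc (lead_coef p) * \prod_(z <- rs) (normc z - 1)) => [|w w1].
  by rewrite mulr_gt0 // big_seq prodr_gt0 // => z /rs1.
rewrite [in leRHS]p_rs hornerZ normcM ler_pM2l // horner_prod.
elim: rs rs1 {p_rs} => [|z rs IH] rs1; first by rewrite !big_nil normc1.
have z1 := rs1 z (mem_head _ _).
rewrite !big_cons normcM hornerXsubC ler_pM ?(ltW z1) //.
- by rewrite big_seq prodr_ge0 // => u urs; rewrite ltW // rs1 // inE urs orbT.
- have := ler_normcB z (- w); rewrite normcN normcBC => h.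
  by apply: le_trans h; lra.
- by apply: IH => u urs; rewrite rs1 // inE urs orbT.
Qed.

(** Along a ray from 0, [|p|^2 - c^2] is a real polynomial in [t], so the intermediate value theorem
    for polynomials applies. *)
Lemma normc_horner_ivt (R : rcfType) (p : {poly R[i]}) (w : R[i]) (c : R) :
    normc p.[0] <= c <= normc p.[w] ->
  exists2 t, 0 <= t <= 1 & normc p.[w * t%:C%C] = c.
Proof.
move=> /andP[c_ge c_le]; have c0 : 0 <= c by apply: le_trans c_ge; exact: normc_ge0.
pose re := \poly_(i < size p) complex.Re (p`_i * w ^+ i).
pose im := \poly_(i < size p) complex.Im (p`_i * w ^+ i).
have reE t : complex.Re p.[w * t%:C%C] = re.[t].
  rewrite horner_poly horner_coef Re_sum; apply: eq_bigr => i _.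
  by rewrite exprMn mulrA -rmorphXn Re_Mreal.
have imE t : complex.Im p.[w * t%:C%C] = im.[t].
  rewrite horner_poly horner_coef Im_sum; apply: eq_bigr => i _.
  by rewrite exprMn mulrA -rmorphXn Im_Mreal.
pose f := re ^+ 2 + im ^+ 2 - (c ^+ 2)%:P.
have fE t : f.[t] = normc p.[w * t%:C%C] ^+ 2 - c ^+ 2.
  by rewrite normc_Re_Im reE imE !hornerE.
have [||t t01 /rootP ft] := @poly_ivt R f 0 1; first exact: ler01.
  rewrite !fE rmorph0 rmorph1 mulr0 mulr1 subr_le0 subr_ge0.
  by rewrite !lerXn2r ?nnegrE ?normc_ge0.
exists t => //; apply/eqP; rewrite -(@eqrXn2 _ 2) ?normc_ge0 //.
by rewrite -subr_eq0 -fE ft.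
Qed.

End Continuity.

(** * The inverse Joukowski map of the slit plane *)

Section OmittedSegment.
Variable R : realType.
Implicit Types (F K W : {poly R[i]}) (w : R[i]) (t s d : R).

(* [K] approximates the branch of the inverse Joukowski map with values in the
   unit disk, evaluated at [(2 F + 1 + t^2) / (1 - t^2)]: this quotient sends
   the segment [[-1, -t^2]] to [[-1, 1]]. *)
Lemma inverse_joukowski_approx F t d : F.[0] = 0 -> 0 < t <= 2^-1 -> 0 < d ->
    (forall s w, t ^+ 2 <= s <= 1 -> normc w <= 1 -> F.[w] + s%:C%C != 0) ->
  exists2 K, K.[0] = ((1 - t) / (1 + t))%:C%C & forall w, normc w <= 1 ->
    normc K.[w] < 1 /\
    normc ((1 - K.[w]) ^+ 2 -
           4 * ((1 - t ^+ 2)^-1)%:C%C * K.[w] * (F.[w] + (t ^+ 2)%:C%C)) <= d.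
Proof.
move=> F0 /andP[t_gt0 t_le] d_gt0 F_omits.
set e := t ^+ 2 in F_omits *; have e_gt0 : 0 < e by rewrite exprn_gt0.
have e_le : e <= 4^-1 by rewrite /e expr2; nra.
have [||gap gap_gt0 F_gap] := @lipschitz_uniform_lower_bound R R[i]
    [set w | normc w <= 1] (fun w s => normc (F.[w] + s%:C%C)) e 1.
- move=> w s u; rewrite distrC -normc_real.
  have -> : F.[w] + u%:C%C = F.[w] + s%:C%C + (u - s)%:C%C.
    by rewrite rmorphB /=; ring.
  exact: le_normcD.
- move=> s s01; have [|d1 d1_gt0 Fd1] := @horner_lower_bound R (F + s%:C%C%:P).
    by move=> w w1; rewrite !hornerE F_omits.
  by exists d1 => // w /Fd1; rewrite !hornerE.
(* For [Z = (2 F + 1 + e) / (1 - e)] one has [Z^2 - 1 = 4 k^2 Q], with [k = 1 / (1 - e)]; thus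
   [K = Z - 2 k W] approximates [Z - sqrt (Z^2 - 1)]. *)
pose Q := (F + e%:C%C%:P) * (F + 1%:P).
have QE w : Q.[w] = (F.[w] + e%:C%C) * (F.[w] + 1).
  by rewrite hornerM !hornerD !hornerC.
(* The 8 absorbs the factor [4 k^2 <= 8] in [err]. The choice [W(0) = t], not [-t], selects the
   branch inside the disk. *)
have [|||W W0 Wsqr] := @sqrt_approx R Q t%:C%C (Num.min d gap / 8).
- by rewrite QE F0 !add0r mulr1 rmorphXn.
- by rewrite divr_gt0 // lt_min d_gt0.
- move=> w w1; rewrite QE; apply: mulf_neq0.
    by apply: F_omits => //; rewrite lexx /=; lra.
  by have := F_omits 1 w; rewrite rmorph1; apply => //; rewrite lexx andbT; lra.
pose k := (1 - e)^-1.
have k_gt0 : 0 < k by rewrite invr_gt0; lra.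
have k_inv : k * (1 - e) = 1 by rewrite mulVf // gt_eqF //; lra.
have k_le : k ^+ 2 <= 2 by rewrite expr2; nra.
pose K := k%:C%C *: (2%:P * F + (1 + e)%:C%C%:P - 2%:P * W).
have KE w : K.[w] = k%:C%C * (2 * F.[w] + (1 + e%:C%C) - 2 * W.[w]).
  by rewrite hornerZ !(hornerD, hornerN, hornerM, hornerC) rmorphD rmorph1.
have k_invC : k%:C%C * (1 - e%:C%C) = 1.
  by rewrite -(rmorph1 (real_complex R)) -rmorphB -rmorphM k_inv.
pose err w := 4 * k%:C%C ^+ 2 * (W.[w] ^+ 2 - Q.[w]).
have err_le w : normc w <= 1 -> normc (err w) <= Num.min d gap.
  move=> w1; rewrite /err normcM [normc (4 * _)]normcM normcX normc_nat ge0_normc_real ?(ltW k_gt0) //.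
  apply: le_trans (ler_wpM2l _ (Wsqr w w1)) _.
    by rewrite mulr_ge0 // exprn_ge0 // ltW.
  have m_gt0 : 0 < Num.min d gap by rewrite lt_min d_gt0.
  by nra.
have K_quadratic w : (1 - K.[w]) ^+ 2 -
    4 * k%:C%C * K.[w] * (F.[w] + e%:C%C) = err w.
  have k_neq0 : k%:C%C != 0 by rewrite fmorph_eq0 gt_eqF.
  have eE : e%:C%C = 1 - k%:C%C^-1.
    by apply: (mulfI k_neq0); rewrite mulrBr mulfV // mulr1 -k_invC; ring.
  by rewrite /err KE QE eE; field.
have K0 : K.[0] = ((1 - t) / (1 + t))%:C%C.
  rewrite KE F0 W0 mulr0 add0r -(rmorph1 (real_complex R)) -(rmorph_nat (real_complex R)).
  rewrite -!rmorphD -!rmorphM -rmorphB -rmorphM; congr (_%:C%C).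
  by rewrite /k /e; field; apply/andP; split; apply/negP => /eqP; nra.
exists K => // w w1; split; last first.
  by rewrite K_quadratic; apply: le_trans (err_le w w1) _; rewrite ge_min lexx.
(* Otherwise [|K| = 1] at some [z] between 0 and [w]. The Joukowski map sends the unit circle to
   [[-1, 1]], so [F(z)] would come too close to the omitted segment. *)
rewrite ltNge; apply/negP => K_ge1.
have K0_le : normc K.[0] <= 1.
  rewrite K0 ge0_normc_real; first by rewrite ler_pdivrMr; lra.
  by apply: divr_ge0; lra.
have [|v v01 Kv] := @normc_horner_ivt R K w 1; first by rewrite K0_le.
set z := w * v%:C%C in Kv.
have z1 : normc z <= 1.
  rewrite normcM normc_real; have := normc_ge0 w.
  by case/andP: v01 => v0 v1 w0; rewrite ger0_norm //; nra.
(* The point [-s] of the segment is the one that [f |-> (2 f + 1 + e) / (1 - e)] sends to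
   [Re K(z)]. *)
pose s := (1 + e - (1 - e) * complex.Re K.[z]) / 2.
have s_range : e <= s <= 1.
  have := ler_Re_normc K.[z]; rewrite Kv ler_norml => /andP[Kge Kle].
  by rewrite /s; apply/andP; split; nra.
have K_conj : K.[z] * conjc K.[z] = 1 by rewrite mul_conjc Kv expr1n.
have Fs : 4 * k%:C%C * (F.[z] + s%:C%C) = - conjc K.[z] * err z.
  have ks : 4 * k%:C%C * (s%:C%C - e%:C%C) = 2 - (K.[z] + conjc K.[z]).
    rewrite addc_conjc -!(rmorph_nat (real_complex R)) -!rmorphB -!rmorphM.
    congr (_%:C%C).
    transitivity (2 * (k * (1 - e)) * (1 - complex.Re K.[z])).
      by rewrite /s; field.
    by rewrite k_inv; ring.
  have -> : F.[z] + s%:C%C = F.[z] + e%:C%C + (s%:C%C - e%:C%C) by ring.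
  rewrite mulrDr ks -K_quadratic.
  move: (K.[z]) (conjc K.[z]) K_conj (F.[z] + e%:C%C) => a b ab f.
  have -> : - b * ((1 - a) ^+ 2 - 4 * k%:C%C * a * f) =
      4 * k%:C%C * f * (a * b) - b + 2 * (a * b) - (a * b) * a by ring.
  by rewrite ab; ring.
have Fs_le : 4 * k * normc (F.[z] + s%:C%C) <= gap.
  rewrite -(ge0_normc_real (ltW k_gt0)) -(normc_nat R) -!normcM Fs normcM normcN.
  rewrite normc_conj Kv mul1r; apply: le_trans (err_le z z1) _.
  by rewrite ge_min lexx orbT.
have := F_gap s z s_range z1.
have k_ge1 : 1 <= k by rewrite /k invf_ge1; lra.
by nra.
Qed.

End OmittedSegment.

(** * Lower bound on the degree of a polynomial omitting the segment *)

Section Growth.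
Variable R : realType.

Lemma omitted_segment_degree (F : {poly R[i]}) N (t : R) :
    (0 < N)%N -> (size F <= N.+1)%N -> F.[0] = 0 -> F.[1] = 1 -> 0 < t ->
    (forall s w, t ^+ 2 <= s <= 1 -> normc w <= 1 -> F.[w] + s%:C%C != 0) ->
  16^-1 < N%:R * t.
Proof.
move=> N_gt0 sz_F F0 F1 t_gt0 F_omits; rewrite ltNge; apply/negP => Nt_le.
have t_le : t <= 16^-1.
  by apply: le_trans Nt_le; rewrite ler_peMl ?ler1n // ltW.
have [||K K0 K_disk] := @inverse_joukowski_approx R F t 8^-1 F0 _ _ F_omits.
- by apply/andP; split; lra.
- by rewrite invr_gt0.
pose G := 1%:P - K.
have GE w : G.[w] = 1 - K.[w] by rewrite hornerD hornerN hornerC.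
have G0 : G`_0 = (2 * t / (1 + t))%:C%C.
  rewrite -horner_coef0 GE K0 -(rmorph1 (real_complex R)) -rmorphB.
  by congr (_%:C%C); field; apply/negP => /eqP; lra.
have G0_le : 2 * t / (1 + t) <= 2 * t by rewrite ler_pdivrMr; nra.
have G0_ge0 : 0 <= 2 * t / (1 + t) by apply: divr_ge0; lra.
(* [G = 1 - K] has positive real part on the disk and [G(0) <= 2 t]. *)
have G_coef k : normc G`_k <= 4 * t.
  have [->|k_gt0] := posnP k; first by rewrite G0 ge0_normc_real //; lra.
  apply: le_trans (normc_coef_le_Re k_gt0 _) _; last by rewrite G0 /=; lra.
  move=> w w1; have [|K_lt1 _] := K_disk w; first by rewrite w1.
  rewrite GE; have := ler_Re_normc K.[w].
  rewrite ler_norml => /andP[_]; case: (K.[w]) K_lt1 => a b /= *; lra.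
have F_small w : normc w = 1 - 8 * t -> normc F.[w] <= 4^-1.
  move=> w_r; have [|_ K_quadratic] := K_disk w; first by rewrite w_r; lra.
  (* The radius [1 - 8 t] makes the geometric bound equal to [4 t / (8 t) = 1 / 2]. *)
  have G_le : normc (1 - K.[w]) <= 2^-1.
    have w_le : normc w <= 1 - 8 * t by rewrite w_r.
    rewrite -GE; apply: le_trans (normc_horner_le G_coef _ _ w_le) _; try lra.
    rewrite (_ : 1 - (1 - 8 * t) = 8 * t); last by ring.
    by rewrite ler_pdivrMr; lra.
  have e_le : t ^+ 2 <= 16^-1 by rewrite expr2; nra.
  have e_ge0 : 0 <= t ^+ 2 by rewrite exprn_ge0 // ltW.
  have k_ge1 : 1 <= (1 - t ^+ 2)^-1 by rewrite invf_ge1; lra.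
  move: K_quadratic G_le; move: (K.[w]) (F.[w]) => a f.
  move: k_ge1 e_ge0 e_le; move: ((1 - t ^+ 2)^-1) => k.
  move: (t ^+ 2) => e k_ge1 e_ge0 e_le.
  set g := 4 * _ * a * _ => g_le a_le.
  have norm_g : normc g = 4 * k * normc a * normc (f + e%:C%C).
    by rewrite !normcM normc_nat ge0_normc_real //; lra.
  have a_ge : 2^-1 <= normc a.
    by have := le_normcD (1 - a) a; rewrite subrK normc1; lra.
  (* Here [3/8 = (1/2)^2 + 1/8], the last term being the tolerance chosen for [K]. As
     [4 k |a| >= 2], it follows that [|f + e| <= 3/16] and [|f| <= 1/4]. *)
  have g_le' : normc g <= 3 / 8.
    have := le_normcD ((1 - a) ^+ 2) (- ((1 - a) ^+ 2 - g)).
    rewrite opprB addrC subrK -opprB normcN normcX expr2.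
    by have := normc_ge0 (1 - a); nra.
  have fe_ge0 := normc_ge0 (f + e%:C%C).
  have fe_le : normc (f + e%:C%C) <= 3 / 16.
    have : 2 * normc (f + e%:C%C) <= normc g; last by lra.
    rewrite norm_g ler_wpM2r //; nra.
  have := le_normcD (f + e%:C%C) (- e%:C%C).
  by rewrite addrK normcN ge0_normc_real //; lra.
have r01 : 0 < 1 - 8 * t < 1 by apply/andP; split; lra.
(* Growth gives [(1 - 8 t)^N <= 1/4], while Bernoulli with [N t <= 1/16] gives at least [1/2]. *)
have := normc_horner1_le sz_F r01 F_small; rewrite F1 normc1 mulr1.
have := @bernoulli_ge R (- (8 * t)) N; lra.
Qed.

End Growth.

(** * Reversal of the averaging and characteristic polynomials *)

Section ReversedPolynomial.
Variables (R : realType) (n : nat) (a : n.-tuple R[i]).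

Definition reversed_averaging_poly : {poly R[i]} := \poly_(i < n) a`_i.

Lemma horner_averaging_poly w : w != 0 ->
  w ^+ n.-1 * (averaging_poly a).[w^-1] = reversed_averaging_poly.[w].
Proof.
move=> w0; rewrite !horner_poly (reindex_inj rev_ord_inj) mulr_sumr /=.
apply: eq_bigr => i _; have i_lt := ltn_ord i.
rewrite subnSK // subKn 1?ltnW // mulrCA; congr (_ * _).
rewrite exprVn -expfB_cond ?(negPf w0) //; last by lia.
by congr (_ ^+ _); lia.
Qed.

(** Multiplying [chi_T(1/w)] by [w^((n-1)T+1)] gives [1 - mu F(w)]; the factor [X] of [F] accounts
    for the [+1] in the exponent. *)
Lemma char_poly_cycle_root T (mu w : R[i]) :
    mu * ('X * reversed_averaging_poly ^+ T).[w] = 1 ->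
  root (char_poly_cycle a T mu) w^-1.
Proof.
rewrite hornerM hornerX horner_exp => muF.
have w0 : w != 0.
  by apply: contra_eq_neq muF => ->; rewrite mul0r mulr0 eq_sym oner_neq0.
have wN : w ^+ (n.-1 * T + 1) != 0 by rewrite expf_neq0.
rewrite rootE; apply/eqP; apply: (mulfI wN); rewrite mulr0.
rewrite !(hornerD, hornerN, hornerZ) hornerXn horner_exp mulrBr -exprMn mulfV // expr1n -[X in X - _]muF.
by rewrite -horner_averaging_poly // exprMn -exprM exprD expr1; ring.
Qed.

Lemma averaging_set_gt0 : averaging_set a -> (0 < n)%N.
Proof.
case: n a => // b [+ _]; rewrite tuple0 big_nil => /esym/eqP.
by rewrite oner_eq0.
Qed.

Lemma reversed_averaging_poly1 : averaging_set a ->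
  reversed_averaging_poly.[1] = 1.
Proof.
move=> [sum1 _]; rewrite -[RHS]sum1 horner_poly (big_nth 0) size_tuple big_mkord.
by apply: eq_bigr => i _; rewrite expr1n mulr1.
Qed.

Lemma size_reciprocal_char_poly (T : nat) : (0 < n)%N ->
  (size ('X * reversed_averaging_poly ^+ T)%R <= (n.-1 * T).+2)%N.
Proof.
move=> n_gt0; apply: leq_trans (size_polyMleq _ _) _; rewrite size_polyX /= ltnS.
apply: leq_trans (size_poly_exp_leq _ _) _; rewrite ltnS leq_mul2r.
by rewrite -!subn1 leq_sub2r ?orbT ?size_poly.
Qed.

End ReversedPolynomial.

(** * From the omitted segment to the bound on [n] *)

Theorem theorem4 (R : realType) (T : nat) :
  exists cT : R, 0 < cT /\
    forall (muM : R) (n : nat) (a : n.-tuple R[i]),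
      1 < muM ->
      averaging_set a ->
      (forall mu : R[i], negative_segment muM mu -> stabilizes a T mu) ->
      cT * Num.sqrt muM <= n%:R.
Proof.
(* The 16 comes from the degree bound, and [T.+1] from [(n-1)T + 1 <= n (T + 1)], which also covers
   [T = 0]. *)
exists (16 * T.+1%:R)^-1; split; first by rewrite invr_gt0 mulr_gt0.
move=> muM n a muM_gt1 a_avg a_stab; have n_gt0 := averaging_set_gt0 a_avg.
have muM_gt0 : 0 < muM by apply: lt_trans muM_gt1.
pose F := 'X * reversed_averaging_poly a ^+ T.
have F0 : F.[0] = 0 by rewrite hornerM hornerX mul0r.
have F1 : F.[1] = 1.
  by rewrite hornerM hornerX horner_exp reversed_averaging_poly1 // expr1n mulr1.
(* If [F(w) = -s], then [1/w] is a root of [chi_T] for [mu = -1/s] in [M], so [|w| > 1]; [w] is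
   nonzero because [F(0) = 0]. *)
have F_omits s w : (Num.sqrt muM)^-1 ^+ 2 <= s <= 1 -> normc w <= 1 ->
    F.[w] + s%:C%C != 0.
  rewrite exprVn sqr_sqrtr ?(ltW muM_gt0) // => /andP[s_ge s_le] w_le.
  apply/eqP => /eqP; rewrite addr_eq0 => /eqP Fw.
  have s_gt0 : 0 < s by apply: lt_le_trans s_ge; rewrite invr_gt0.
  have mu_seg : negative_segment muM (- s^-1)%:C%C.
    split=> //=; rewrite lerN2 lerN2 invf_ge1 // s_le andbT.
    by rewrite -[leRHS]invrK lef_pV2 ?posrE ?invr_gt0.
  have w_root : root (char_poly_cycle a T (- s^-1)%:C%C) w^-1.
    apply: char_poly_cycle_root; rewrite -/F Fw rmorphN mulrNN -rmorphM.
    by rewrite mulVf ?gt_eqF.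
  have := a_stab _ mu_seg _ w_root.
  rewrite /unit_disk /= normcE_norm -(rmorph1 (real_complex R)) ltcR normcV.
  rewrite invf_lt1; first by rewrite ltNge w_le.
  rewrite lt_def normc_ge0 andbT; apply/eqP => /eq0_normc w0.
  move: Fw; rewrite w0 F0 => /esym/eqP; rewrite oppr_eq0 fmorph_eq0.
  by rewrite gt_eqF.
have sz_F := size_reciprocal_char_poly a T n_gt0.
have sqrt_gt0 : 0 < Num.sqrt muM by rewrite sqrtr_gt0.
have t_gt0 : 0 < (Num.sqrt muM)^-1 by rewrite invr_gt0.
have := omitted_segment_degree (ltn0Sn (n.-1 * T)) sz_F F0 F1 t_gt0 F_omits.
rewrite ltr_pdivlMr // => N_gt.
rewrite mulrC ler_pdivrMr ?mulr_gt0 // mulrCA.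
have N_le : (n.-1 * T).+1%:R <= n%:R * T.+1%:R :> R.
  by rewrite -natrM ler_nat; case: (n) n_gt0 => // m _ /=; lia.
lra.
Qed.
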